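(* For every integer $r\geq 4$, there exists a constant $c>0$ such that for every integer $n\ge 2$, $$R_{r}^{1,1,1}(n)\geq 2^{cn^{\lfloor r/2\rfloor-1}}.$$
   Context: An $r$-uniform hypergraph $H$ is semi-algebraic of complexity $(d,D,m)$ if there is an enumeration $v_1,\dots,v_N$ of its vertices, an assignment $v_i\mapsto p_i\in\mathbb{R}^d$ for $i\in[N]=\{1,\dots,N\}$, $m$ polynomials $f_1,\dots,f_m:(\mathbb{R}^d)^r\to\mathbb{R}$ of (total) degree at most $D$, and a function $\Phi:\{+,-,0\}^m\to\{\text{True},\text{False}\}$ such that for all $1\le i_1<\dots<i_r\le N$, the set $\{v_{i_1},\dots,v_{i_r}\}$ is an edge of $H$ if and only if $\Phi(\operatorname{sign}f_1(p_{i_1},\dots,p_{i_r}),\dots,\operatorname{sign}f_m(p_{i_1},\dots,p_{i_r}))=\text{True}$, where $\operatorname{sign}(x)\in\{+,-,0\}$ is the sign of $x$. The Ramsey number $R_r^{d,D,m}(n)$ is the smallest $N$ such that every $r$-uniform semi-algebraic hypergraph of complexity $(d,D,m)$ on $N$ vertices contains either a clique of size $n$ (a set of $n$ vertices all of whose $r$-element subsets are edges) or an independent set of size $n$ (a set of $n$ vertices none of whose $r$-element subsets is an edge). *)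

(* Defs.v *)
From mathcomp Require Import all_boot all_order all_algebra.
From mathcomp Require Import mpoly.
From mathcomp Require Import boolp reals exp.

Set Implicit Arguments.
Unset Strict Implicit.
Unset Printing Implicit Defensive.

Import Order.TTheory GRing.Theory Num.Theory.
Local Open Scope ring_scope.

(* A hypergraph is given by a finite vertex type V and an edge set
   E : {set {set V}}. *)
Definition uniform (r : nat) (V : finType) (E : {set {set V}}) : Prop :=
  forall e : {set V}, e \in E -> #|e| = r.

Definition clique (r : nat) (V : finType) (E : {set {set V}})
    (S : {set V}) : Prop :=
  forall e : {set V}, e \subset S -> #|e| = r -> e \in E.

Definition independent (r : nat) (V : finType) (E : {set {set V}})
    (S : {set V}) : Prop :=
  forall e : {set V}, e \subset S -> #|e| = r -> e \notin E.

Inductive sign := Plus | Minus | Zero.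

Definition sign_of (R : realType) (x : R) : sign :=
  if 0 < x then Plus else if x < 0 then Minus else Zero.

(* A function (R^d)^r -> R is a function of r * d real variables: the r points
   are the rows of an r x d matrix, which mxvec flattens.  As msize is the total
   degree plus one (and 0 for the zero polynomial), msize (f j) <= D.+1 says
   that f j has total degree at most D. *)
Definition semialgebraic (R : realType) (r d D m : nat) (V : finType)
    (E : {set {set V}}) : Prop :=
  exists (v : 'I_#|V| -> V) (p : 'I_#|V| -> 'rV[R]_d)
    (f : 'I_m -> {mpoly R[r * d]}) (Phi : m.-tuple sign -> bool),
    [/\ bijective v,
        forall j : 'I_m, (msize (f j) <= D.+1)%N &
        forall i : 'I_r -> 'I_#|V|,
          (forall a b : 'I_r, (a < b)%N -> (i a < i b)%N) ->
          ([set v (i k) | k : 'I_r] \in E) =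
          Phi [tuple sign_of
                 (f j).@[fun l => mxvec (\matrix_(k < r) p (i k)) 0 l]
              | j < m]].

Definition ramsey_property (R : realType) (r d D m n N : nat) : Prop :=
  forall (V : finType) (E : {set {set V}}),
    #|V| = N -> uniform r E -> semialgebraic R r d D m E ->
    exists S : {set V}, #|S| = n /\ (clique r E S \/ independent r E S).

Lemma ramsey_extend (V : finType) (c : {set V} -> bool) (r a : nat) (b : bool)
    (x : V) (S T : {set V}) :
  x \notin S -> T \subset S -> #|T| = a ->
  (forall e : {set V}, e \subset S -> #|e| = r -> c (x |: e) = b) ->
  (forall e : {set V}, e \subset T -> #|e| = r.+1 -> c e = b) ->
  #|x |: T| = a.+1 /\
  (forall e : {set V}, e \subset x |: T -> #|e| = r.+1 -> c e = b).
Proof.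
move=> xS TS cT hS hT; split.
  by rewrite cardsU1 (contra (subsetP TS x) xS) cT.
move=> e eT ce; case: (boolP (x \in e)) => xe.
  rewrite -(setD1K xe); apply: hS.
    by apply: subset_trans TS; rewrite subDset.
  by move: ce; rewrite (cardsD1 x) xe => -[].
apply: hT => //; apply/subsetP => y ye.
move/subsetP: eT => /(_ y ye); rewrite !inE => /orP[/eqP yx|//].
by rewrite -yx ye in xe.
Qed.

(* Ramsey's theorem for uniform hypergraphs, by the Erdos-Szekeres recursion. *)
Lemma ramsey_theorem (r a b : nat) :
  exists N : nat, forall (V : finType) (c : {set V} -> bool) (A : {set V}),
    (N <= #|A|)%N ->
    (exists S : {set V}, [/\ S \subset A, #|S| = a &
       forall e : {set V}, e \subset S -> #|e| = r -> c e = true]) \/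
    (exists S : {set V}, [/\ S \subset A, #|S| = b &
       forall e : {set V}, e \subset S -> #|e| = r -> c e = false]).
Proof.
elim: r a b => [|r IHr] a b.
  exists (maxn a b) => V c A; rewrite geq_max => /andP[aA bA].
  have sub k : (k <= #|A|)%N -> exists S : {set V}, S \subset A /\ #|S| = k.
    move=> /card_geqP[s [us cs sA]]; exists [set y in s]; split.
      by apply/subsetP => y; rewrite inE => /sA.
    by rewrite cardsE (card_uniqP us).
  have [S [SA cS]] := sub a aA; have [T [TA cT]] := sub b bA.
  by case c0: (c set0); [left; exists S | right; exists T];
    split=> // e _ /cards0_eq ->.
move: {2}(a + b)%N (leqnn (a + b)) => s.
elim: s a b => [|s IHs] [|a] b le_s //.
- by exists 0%N => V c A _; left; exists set0; split;
    rewrite ?sub0set ?cards0 // => e; rewrite subset0 => /eqP ->; rewrite cards0.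
- by exists 0%N => V c A _; left; exists set0; split;
    rewrite ?sub0set ?cards0 // => e; rewrite subset0 => /eqP ->; rewrite cards0.
case: b le_s => [|b] le_s.
  by exists 0%N => V c A _; right; exists set0; split;
    rewrite ?sub0set ?cards0 // => e; rewrite subset0 => /eqP ->; rewrite cards0.
have [|Na hNa] := IHs a b.+1; first by rewrite addSn in le_s.
have [|Nb hNb] := IHs a.+1 b; first by rewrite addnS in le_s.
have [N hN] := IHr Na Nb.
exists N.+1 => V c A NA.
have [x xA] : exists x, x \in A by apply/card_gt0P; apply: leq_trans NA.
have NA' : (N <= #|A :\ x|)%N by move: NA; rewrite (cardsD1 x) xA.
have xAx (S : {set V}) : S \subset A :\ x -> x \notin S.
  by move=> /subsetP h; apply/negP => /h; rewrite !inE eqxx.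
have AxA : A :\ x \subset A by apply: subsetDl.
have xTA (T : {set V}) : T \subset A -> x |: T \subset A.
  by move=> TA; rewrite subUset sub1set xA.
case: (hN V (fun e => c (x |: e)) (A :\ x) NA') => -[S [SA cS hS]].
  case: (hNa V c S); first by rewrite cS.
    move=> [T [TS cT hT]]; left; exists (x |: T).
    have [] := ramsey_extend (xAx _ SA) TS cT hS hT.
    by split=> //; apply: xTA; apply: subset_trans AxA; apply: subset_trans SA.
  move=> [T [TS cT hT]]; right; exists T; split=> //.
  by apply: subset_trans AxA; apply: subset_trans SA.
case: (hNb V c S); first by rewrite cS.
  move=> [T [TS cT hT]]; left; exists T; split=> //.
  by apply: subset_trans AxA; apply: subset_trans SA.
move=> [T [TS cT hT]]; right; exists (x |: T).
have [] := ramsey_extend (xAx _ SA) TS cT hS hT.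
by split=> //; apply: xTA; apply: subset_trans AxA; apply: subset_trans SA.
Qed.

Lemma ramsey_property_exists (R : realType) (r d D m n : nat) :
  exists N : nat, `[< ramsey_property R r d D m n N >].
Proof.
have [N hN] := ramsey_theorem r n n; exists N; apply/asboolP => V E cV _ _.
case: (hN V (fun e => e \in E) setT); first by rewrite cardsT cV.
  by move=> [S [_ cS hS]]; exists S; split=> //; left.
move=> [S [_ cS hS]]; exists S; split=> //; right => e eS ce.
by rewrite hS.
Qed.

Definition ramsey_number (R : realType) (r d D m n : nat) : nat :=
  ex_minn (ramsey_property_exists R r d D m n).

(* Main.v *)
(* Put K = floor(r/2) - 1.  The vertices are the leaves x < 2^m of a binary tree,
   with m = g^K - 1, sent to the reals sum_t bit_t(x) w(t+1) for a very fast
   growing w, so that y - x is close to w(t) for t the height of the lowest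
   common ancestor of x and y.  The edges are given by the sign of
   sum_{j<2K} c_j (x_{j+1} - x_j), where the c_j alternate in sign; the last
   points are ignored.  It is the sign of the dominating term.

   The signs of the two middle terms differ and their coefficients are maximal,
   so a homogeneous set cannot branch into two sets of more than K leaves: its
   tree is a caterpillar, and a positive fraction of its leaves forms a comb,
   along which the heights decrease (or, after reversal, increase).  On a comb
   the exponents of w and of the c_j make the dominating term tell at which
   index the heights, read in base g, first separate at the level attached to
   that index.  Constancy of the parity of this index forces the comb to have
   O(g) leaves.  So homogeneous sets have O(g) elements among about 2^(g^K)
   vertices. *)
Require Import Defs.
From mathcomp Require Import all_boot all_order all_algebra.
From mathcomp Require Import boolp reals exp mpoly zify ring lra.

Set Implicit Arguments.
Unset Strict Implicit.
Unset Printing Implicit Defensive.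

Import Order.TTheory GRing.Theory Num.Theory.

(** * Binary trees on the natural numbers *)

Lemma hgt_exists x y : exists t, (x %/ 2 ^ t == y %/ 2 ^ t)%N.
Proof.
exists (maxn x y); rewrite !divn_small //.
  by apply: leq_ltn_trans (leq_maxr x y) (ltn_expl _ _).
by apply: leq_ltn_trans (leq_maxl x y) (ltn_expl _ _).
Qed.

(* Height of the lowest common ancestor of the leaves [x] and [y] of the
   infinite binary tree whose nodes at height [t] are the intervals
   [q * 2 ^ t, (q + 1) * 2 ^ t). *)
Definition hgt x y := ex_minn (hgt_exists x y).

Lemma hgt_leE x y t : (hgt x y <= t)%N = (x %/ 2 ^ t == y %/ 2 ^ t)%N.
Proof.
rewrite /hgt; case: ex_minnP => u /eqP xy min_u; apply/idP/idP => [ut|/min_u //].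
by rewrite -(subnKC ut) expnD !divnMA xy.
Qed.

Lemma hgtC x y : hgt x y = hgt y x.
Proof.
by apply/eqP; rewrite eqn_leq !hgt_leE eq_sym -hgt_leE leqnn eq_sym -hgt_leE leqnn.
Qed.

Lemma hgt_eqS x y t :
  (x %/ 2 ^ t.+1 = y %/ 2 ^ t.+1 -> x %/ 2 ^ t != y %/ 2 ^ t ->
  hgt x y = t.+1)%N.
Proof.
by move=> xy nxy; apply/eqP; rewrite eqn_leq hgt_leE xy eqxx ltnNge hgt_leE.
Qed.

Lemma hgt_le_exp m x y : (x < 2 ^ m)%N -> (y < 2 ^ m)%N -> (hgt x y <= m)%N.
Proof. by move=> xm ym; rewrite hgt_leE !divn_small. Qed.

Lemma divn_exp2S x t : (x %/ 2 ^ t.+1 = (x %/ 2 ^ t)./2)%N.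
Proof. by rewrite expnSr divnMA divn2. Qed.

(** * Lists of natural numbers *)

Lemma sorted_filter_split (c : nat) (s : seq nat) : sorted ltn s ->
  [seq x <- s | (x < c)%N] ++ [seq x <- s | (c <= x)%N] = s.
Proof.
elim: s => //= x s IHs xs; have [xc|cx] := ltnP x c.
  by rewrite /= IHs // (path_sorted xs).
have /allP xs' := order_path_min ltn_trans xs.
have -> : [seq y <- s | (y < c)%N] = [::].
  rewrite -(filter_pred0 s); apply: eq_in_filter => y /xs' /= xy.
  by apply/negbTE; rewrite -leqNgt (leq_trans cx) // ltnW.
rewrite -[in RHS](filter_predT s) /=; congr cons; apply: eq_in_filter => y /xs' /= xy.
by rewrite (leq_trans cx) // ltnW.
Qed.

Lemma gtn_sorted_filter_split (f : nat -> nat) (c : nat) (s : seq nat) :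
  sorted (fun x y => f y <= f x)%N s ->
  [seq x <- s | (c <= f x)%N] ++ [seq x <- s | (f x < c)%N] = s.
Proof.
have tr : transitive (fun x y => f y <= f x)%N by move=> y x z; lia.
elim: s => //= x s IHs xs; have [cx|xc] := leqP c (f x).
  by rewrite /= IHs // (path_sorted xs).
have /allP xs' := order_path_min tr xs.
have -> : [seq y <- s | (c <= f y)%N] = [::].
  rewrite -(filter_pred0 s); apply: eq_in_filter => y /xs' /= xy.
  by apply/negbTE; rewrite -ltnNge (leq_ltn_trans xy).
rewrite -[in RHS](filter_predT s) /=; congr cons; apply: eq_in_filter => y /xs' /= xy.
by rewrite (leq_ltn_trans xy).
Qed.

Lemma size_uniq_divn (s : seq nat) (g q : nat) : uniq s ->
  {in s, forall x, x %/ g = q} -> (0 < g)%N -> (size s <= g)%N.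
Proof.
move=> us sq g0; rewrite -(size_iota (q * g) g); apply: uniq_leq_size => // x xs.
rewrite mem_iota; have := divn_eq x g; have := ltn_pmod x g0; rewrite (sq _ xs); lia.
Qed.

(** With [f] the block number, [x] and [y] are the first two neighbours in a common block, and the
    entries of [rcons A x] lie in distinct blocks. *)
Lemma sorted_first_repeat (f : nat -> nat) (s : seq nat) :
  sorted (fun x y => f y <= f x)%N s ->
  sorted (fun x y => f y < f x)%N s \/
  exists A x y C, [/\ s = A ++ x :: y :: C,
    sorted (fun x y => f y < f x)%N (rcons A x) & f x = f y].
Proof.
elim: s => [|z [|w s] IHs] /=; [by left | by left |].
move=> /andP[]; rewrite leq_eqVlt => /orP[/eqP wz _|wz ps].
  by right; exists [::], z, w, s.
have [h|[A [x [y [C [sE sA xy]]]]]] := IHs ps; first by left; rewrite wz.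
right; exists (z :: A), x, y, C; split=> //=; first by rewrite sE.
by case: A sE sA => [|a A] /= [<- _] h; rewrite wz.
Qed.

(** * Parity of the turn in decreasing sequences *)

Section Turn.
Variable g : nat.
Hypothesis g_gt0 : (0 < g)%N.

(* The first index [i] such that the entries [i] and [i + 1] of [s] have distinct
   quotients by [g ^ (k - 1 - i)], and [k - 1] if there is none: see [turn_spec]. *)
Fixpoint turn (k : nat) (s : seq nat) : nat :=
  if k is k'.+1 then
    if s is x :: s' then
      if s' is y :: _ then
        if (x %/ g ^ k' == y %/ g ^ k')%N then (turn k' s').+1 else 0%N
      else 0%N
    else 0%N
  else 0%N.

Lemma turn_spec k s : size s = k.+1 ->
  let j := turn k.+1 s in
  [/\ (j <= k)%N,
      forall i, (i < j)%N ->
        (nth 0 s i %/ g ^ (k - i) = nth 0 s i.+1 %/ g ^ (k - i))%N &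
      (j < k)%N -> (nth 0 s j %/ g ^ (k - j) != nth 0 s j.+1 %/ g ^ (k - j))%N].
Proof.
elim: k s => [|k IHk] [|x [|y s]] //= [szs].
have [/= jk lt_j at_j] := IHk (y :: s) (congr1 S szs).
case: eqP => [xy|/eqP nxy]; last by split; rewrite ?subn0.
split=> //; first by case=> [|i] //= ij; rewrite ?subn0 // subSS; apply: lt_j.
Qed.

(* Call entries with the same quotient by [g ^ k] a block.  All blocks but one
   are singletons, apart from the last entries: if [x] and [y] share a block,
   then [x :: y :: e] and [y :: e] have turns 1 and 0 for [e] in later blocks. *)
Lemma turn_constant_bound k L b q : sorted gtn L ->
  {in L, forall x, x %/ g ^ k.+1 = q}%N ->
  (forall s, subseq s L -> size s = k.+1 -> odd (turn k.+1 s) = b) ->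
  (size L <= k.+1 * (g + k.+1))%N.
Proof.
elim: k L b q => [|k IHk] L b q Lgt Lq Lb.
  rewrite mul1n; apply: leq_trans (leq_addr _ _).
  apply: (@size_uniq_divn _ _ q) => //.
  by move: Lgt; rewrite gtn_sorted_uniq_geq => /andP[].
pose f x := (x %/ g ^ k.+1)%N.
have fq x : x \in L -> (f x %/ g = q)%N.
  by move=> xL; rewrite /f -divnMA -expnSr; apply: Lq.
have f_gt (s : seq nat) : sorted (fun x y => f y < f x)%N s -> {subset s <= L} ->
    (size s <= g)%N.
  move=> sf sL; rewrite -(size_map f); apply: (@size_uniq_divn _ _ q) => //.
    have : sorted gtn (map f s) by rewrite sorted_map.
    by rewrite gtn_sorted_uniq_geq => /andP[].
  by move=> _ /mapP[x /sL xL ->]; apply: fq.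
have Lf : sorted (fun x y => f y <= f x)%N L.
  by apply: sub_sorted Lgt => x y /ltnW; apply: leq_div2r.
have [/f_gt h|[A [x [y [C [LE Ax xy]]]]]] := sorted_first_repeat Lf.
  by apply: leq_trans (h _) _ => //; lia.
have szA : (size (rcons A x) <= g)%N.
  by apply: f_gt Ax _ => z zA; rewrite LE -cat_rcons mem_cat zA.
have Cf : sorted (fun x y => f y <= f x)%N (y :: C).
  by apply: subseq_sorted Lf; [move=> ? ? ?; lia | rewrite LE -cat_rcons suffix_subseq].
have := gtn_sorted_filter_split (f x) Cf.
set B := filter _ _; set E := filter _ _ => BE.
have subL s : subseq s (x :: y :: C) -> subseq s L.
  by move=> /subseq_trans; apply; rewrite LE suffix_subseq.
have szE : (size E <= k)%N.
  rewrite leqNgt; apply/negP => kE.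
  have BE' : subseq (y :: E) (y :: C).
    rewrite -BE -(cat1s y E) cat_subseq // sub1seq mem_filter xy leqnn.
    exact: mem_head.
  have Ef e : e \in E -> (f e < f y)%N by rewrite -xy mem_filter => /andP[].
  case: E BE BE' kE Ef {szA} => // e E BE BE' kE Ef.
  have far : (f y != f e)%N by rewrite eq_sym ltn_eqF // Ef ?mem_head.
  have b0 : b = false.
    rewrite -(Lb (y :: take k.+1 (e :: E))) /= -/(f y) -/(f e) ?(negbTE far) //.
      apply: subL; apply: subseq_trans (subseq_cons _ _).
      by apply: subseq_trans BE'; rewrite /= !eqxx take_subseq.
    by rewrite size_takel.
  (* Distinct quotients by [g ^ k.+1] force distinct quotients by [g ^ k]. For [k = 0] the value is
     the default of [turn] on a singleton. *)
  have turn0 : turn k.+1 (y :: take k (e :: E)) = 0%N.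
    move: far; rewrite /f; case: (k) => //= k' far; case: eqP => // ye; move: far.
    by rewrite !(expnSr _ k'.+1) !divnMA ye eqxx.
  have : odd (turn k.+2 (x :: y :: take k (e :: E))) = b.
    apply: Lb; last by rewrite /= size_takel // ltnW.
    apply: subL; apply: (@subseq_trans _ [:: x, y, e & E]); last by rewrite /= eqxx.
    exact: (@cat_subseq _ [:: x; y] _ [:: x; y] _ (subseq_refl _) (take_subseq _ _)).
  by rewrite b0 [turn _ _]/= -/(f x) -/(f y) xy eqxx -/(turn k.+1 (y :: _)) turn0.
have fB z : z \in B -> f z = f x.
  rewrite mem_filter => /andP[xz zC]; apply/eqP; rewrite eqn_leq xz andbT xy.
  have tr : transitive (fun u v => f v <= f u)%N by move=> u v t; lia.
  by move: zC (allP (order_path_min tr Cf) z); rewrite inE => /predU1P[->|zC] // ->.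
have szB : (size B <= k.+1 * (g + k.+1))%N.
  have BL : subseq B L.
    by apply: subL; apply: subseq_trans (filter_subseq _ _) (subseq_cons _ _).
  (* All of [B] lies in the block of [x], so prepending [x] raises the turn by one and flips its
     parity. *)
  apply: (IHk B (~~ b) (f x)) => //.
    by apply: subseq_sorted BL Lgt; exact: rev_trans ltn_trans.
  case=> // z s sB szs; apply: negb_inj; rewrite negbK -(Lb (x :: z :: s)).
  - by rewrite [in RHS]/= -/(f x) -/(f z) (fB z) ?eqxx // (mem_subseq sB) ?mem_head.
  - apply: subL; rewrite -[x :: z :: s]cat1s -[x :: y :: C]cat1s.
    by apply: cat_subseq => //; apply: subseq_trans sB (filter_subseq _ _).
  - by move: szs => /= ->.
have := congr1 size LE; rewrite -cat_rcons -BE !size_cat.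
by move=> ->; nia.
Qed.
End Turn.

(** * Combs in sets of leaves *)

(* The leaves of [s], in this order, hang from a path going down the tree, [D]
   giving the heights where they branch off; the last value of [D] is free. *)
Definition comb (D : nat -> nat) (s : seq nat) :=
  pairwise (fun x y => (hgt x y == D x) && (D y < D x))%N s.

Lemma comb_cons D s x t : comb D s -> {in s, forall y, hgt x y = t.+1} ->
  {in s, forall y, D y <= t}%N ->
  exists D', comb D' (x :: s) /\ {in x :: s, forall y, D' y <= t.+1}%N.
Proof.
move=> Ds xs Dt; exists (fun y => if y \in s then D y else t.+1).
have xNs : x \notin s.
  by apply/negP => /xs; have := hgt_leE x x 0; rewrite eqxx leqn0 => /eqP ->.
split=> /=; last first.
  by move=> y _; case: ifP => // /Dt /leqW.
rewrite /comb /= (negbTE xNs); apply/andP; split.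
  by apply/allP => y ys; rewrite xs // ys eqxx ltnS Dt.
apply: sub_in_pairwise Ds; last by apply/allP => y; apply.
by move=> y z /= ys zs; rewrite ys zs.
Qed.

(** The leaves below a node of height [t.+1] split into two halves, one of which has at most [K]
    leaves since the tree has no balanced branching. Recursion on the other half yields two combs,
    and one leaf of the small half is put in front of one of them: of [l] if the small half is on
    the left, of [r], which is listed from right to left, otherwise. Each such leaf pays for the at
    most [K] leaves of its half. *)
Lemma comb_extract K t q s : sorted ltn s ->
  {in s, forall x, x %/ 2 ^ t = q}%N ->
  (forall u l r, subseq (l ++ r) s -> size l = K.+1 -> size r = K.+1 ->
    {in l &, forall x y, hgt x y <= u}%N ->
    {in r &, forall x y, hgt x y <= u}%N ->
    ~ {in l & r, forall x y, hgt x y = u.+1}) ->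
  exists D D' l r, [/\ subseq l s, comb D l, subseq (rev r) s, comb D' r &
    (size s <= K.+1 * (size l + size r))%N] /\
    ({in l, forall x, D x <= t}%N /\ {in r, forall x, D' x <= t}%N).
Proof.
elim: t q s => [|t IHt] q s ss sq bal.
  exists (fun _ => 0%N), (fun _ => 0%N), s, [::]; split=> //; split=> //.
  - have: (size s <= 1)%N.
      apply: (@size_uniq_divn _ _ q) => //.
      by move: ss; rewrite ltn_sorted_uniq_leq => /andP[].
    by case: s {ss sq bal} => [|x []].
  - exact: sub0seq.
  - by rewrite addn0 leq_pmull.
(* The first leaf of the right child. *)
set c := ((q.*2).+1 * 2 ^ t)%N.
have := sorted_filter_split c ss; set l := filter _ _; set r := filter _ _ => lr.
have lq x : x \in l -> (x %/ 2 ^ t = q.*2)%N.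
  rewrite mem_filter => /andP[]; rewrite -ltn_divLR ?expn_gt0 // => xc /sq.
  by rewrite divn_exp2S => xq; lia.
have rq x : x \in r -> (x %/ 2 ^ t = q.*2.+1)%N.
  rewrite mem_filter => /andP[]; rewrite -leq_divRL ?expn_gt0 // => xc /sq.
  by rewrite divn_exp2S => xq; lia.
have sl : subseq l s := filter_subseq _ _.
have sr : subseq r s := filter_subseq _ _.
have hlr x y : x \in l -> y \in r -> hgt x y = t.+1.
  move=> xl yr; apply: hgt_eqS; last by rewrite lq // rq // ltn_eqF.
  by rewrite (sq x (mem_subseq sl xl)) (sq y (mem_subseq sr yr)).
have ltr : transitive ltn by exact: ltn_trans.
have [|lK] := leqP (size l) K.
  move=> lK.
  have [|||D [D' [l' [r' [[sl' cl sr' cr szr] [Dl Dr]]]]]] := IHt (q.*2.+1) r.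
  - exact: (subseq_sorted ltr sr ss).
  - exact: rq.
  - by move=> u a b ab; apply: bal; apply: subseq_trans ab sr.
  have szs : size s = (size l + size r)%N by rewrite -size_cat lr.
  case: l lr lq sl hlr lK szs => [|x l] lr lq sl hlr lK szs.
    exists D, D', l', r'; split; first by rewrite -lr.
    by split=> x xl; apply: leqW; [apply: Dl | apply: Dr].
  have [|E [cE Et]] := comb_cons cl _ Dl (x := x).
    by move=> y /(mem_subseq sl') yr; apply: hlr; rewrite ?mem_head.
  exists E, D', (x :: l'), r'; split; last by split=> // y /Dr /leqW.
  split=> //; last by rewrite szs [X in (_ <= _ * X)%N]addSn mulnS leq_add // ltnW.
  - by rewrite -lr -cat1s cat_subseq // sub1seq mem_head.
  - exact: subseq_trans sr.
have [|rK] := leqP (size r) K.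
  move=> rK.
  have [|||D [D' [l' [r' [[sl' cl sr' cr szr] [Dl Dr]]]]]] := IHt (q.*2) l.
  - exact: (subseq_sorted ltr sl ss).
  - exact: lq.
  - by move=> u a b ab; apply: bal; apply: subseq_trans ab sl.
  have szs : size s = (size l + size r)%N by rewrite -size_cat lr.
  case: r lr rq sr hlr rK szs => [|x r] lr rq sr hlr rK szs.
    rewrite cats0 in lr; exists D, D', l', r'; split; first by rewrite -lr.
    by split=> x xl; apply: leqW; [apply: Dl | apply: Dr].
  have [|E [cE Et]] := comb_cons cr _ Dr (x := x).
    move=> y yr; rewrite hgtC; apply: hlr; rewrite ?mem_head //.
    by apply: (mem_subseq sr'); rewrite mem_rev.
  exists D, E, l', (x :: r'); split; last by split=> // y /Dl /leqW.
  split=> //; last by rewrite szs [X in (_ <= _ * X)%N]addnS mulnS addnC leq_add // ltnW.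
  - exact: subseq_trans sl.
  - by rewrite -lr rev_cons -cats1 cat_subseq // sub1seq mem_head.
have [tl tr] := (take_subseq l K.+1, take_subseq r K.+1).
case: (bal t (take K.+1 l) (take K.+1 r)).
- by rewrite -lr cat_subseq.
- by rewrite size_takel.
- by rewrite size_takel.
- by move=> x y /(mem_subseq tl) xl /(mem_subseq tl) yl; rewrite hgt_leE !lq.
- by move=> x y /(mem_subseq tr) xr /(mem_subseq tr) yr; rewrite hgt_leE !rq.
- by move=> x y /(mem_subseq tl) xl /(mem_subseq tr) yr; apply: hlr.
Qed.

(** * Exponents *)

Section Exponents.
Variables k g : nat.
Hypothesis g_gt0 : (0 < g)%N.

(** The quotients [t %/ g ^ l] of heights [t < g ^ k.+1] serve as digits in this radix; even when
    doubled they stay below it. *)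
Definition radix := (2 * g ^ k.+1)%N.

Definition expo_upto n t := (\sum_(l < n) (t %/ g ^ l) * radix ^ l)%N.

(* Distances between exponents show, up to a factor, the highest level at which
   the arguments lie in different blocks: see [expo_far] and [expo_close]. *)
Definition expo t := (2 * expo_upto k.+1 t)%N.

Lemma radix_gt1 : (1 < radix)%N.
Proof. by rewrite /radix; have := expn_gt0 g k.+1; rewrite g_gt0; lia. Qed.

Lemma radix_exp_gt0 l : (0 < radix ^ l)%N.
Proof. by rewrite expn_gt0 ltnW ?radix_gt1. Qed.

Lemma expo_far l t u : (l <= k)%N -> (t < u)%N ->
  (t %/ g ^ l != u %/ g ^ l)%N -> (expo t + 2 * radix ^ l <= expo u)%N.
Proof.
move=> lk tu ntu; rewrite /expo -mulnDr leq_pmul2l // /expo_upto.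
have lk' : (l < k.+1)%N by [].
rewrite (bigD1 (Ordinal lk')) //= [X in (_ <= X)%N](bigD1 (Ordinal lk')) //=.
have div_le i : (t %/ g ^ i <= u %/ g ^ i)%N by apply: leq_div2r; apply: ltnW.
rewrite addnAC leq_add //; last by apply: leq_sum => i _; rewrite leq_mul.
by rewrite addnC -mulSn leq_mul // ltn_neqAle ntu div_le.
Qed.

Lemma expo_lt t u : (t < u)%N -> (expo t < expo u)%N.
Proof.
move=> tu; have := @expo_far 0 t u (leq0n _) tu; rewrite expn0 !divn1.
by move=> /(_ _) h; have := h (negbT (ltn_eqF tu)); lia.
Qed.

(** The digits from level [l] on agree, and twice the number formed by the lower digits of [u] is
    less than [radix ^ l]. *)
Lemma expo_close l t u : (l <= k.+1)%N -> (u < g ^ k.+1)%N ->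
  (t %/ g ^ l = u %/ g ^ l)%N -> (expo u < expo t + radix ^ l)%N.
Proof.
move=> lk uk tu.
have low n : (2 * expo_upto n u < 2 * expo_upto n t + radix ^ n)%N.
  elim: n => [|n IHn]; first by rewrite /expo_upto !big_ord0.
  rewrite /expo_upto !big_ord_recr /= -/(expo_upto n u) -/(expo_upto n t).
  have : (u %/ g ^ n < g ^ k.+1)%N by apply: leq_ltn_trans uk; apply: leq_div.
  have -> : (radix ^ n.+1 = 2 * g ^ k.+1 * radix ^ n)%N by rewrite expnS.
  have := radix_exp_gt0 n; move: IHn.
  move: (radix ^ n)%N (u %/ _)%N (t %/ _)%N (g ^ k.+1)%N (expo_upto n u) (expo_upto n t).
  by move=> a b c d p q pq a0 bd; have := leq_mul bd (leqnn a); lia.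
have split_sum v : (expo_upto k.+1 v =
    expo_upto l v + \sum_(l <= i < k.+1) (v %/ g ^ i) * radix ^ i)%N.
  by rewrite /expo_upto -!(big_mkord xpredT (fun i => v %/ g ^ i * radix ^ i)%N)
    -(big_cat_nat (n := l)).
have high : (\sum_(l <= i < k.+1) (u %/ g ^ i) * radix ^ i =
             \sum_(l <= i < k.+1) (t %/ g ^ i) * radix ^ i)%N.
  rewrite big_nat [RHS]big_nat; apply: eq_bigr => i /andP[li _].
  by rewrite -(subnKC li) expnD !divnMA tu.
by rewrite /expo !split_sum high !mulnDr addnAC ltn_add2r low.
Qed.

Definition lift_upto j := (\sum_(i < j) radix ^ (k - i))%N.

(* Exponents of the coefficients.  The increment [radix ^ (k - i)] is the threshold
   between [expo_close] and [expo_far] at level [k - i]; the symmetry in [j] and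
   [2 * k + 1 - j] lets reversed combs be treated like combs. *)
Definition lift j := lift_upto (minn j (2 * k + 1 - j)).

Lemma lift_upto_mono a b : (a <= b)%N -> (lift_upto a <= lift_upto b)%N.
Proof.
move=> ab; rewrite /lift_upto -!(big_mkord xpredT (fun i => radix ^ (k - i))%N).
by rewrite [X in (_ <= X)%N](big_cat_nat (n := a)) //= leq_addr.
Qed.

(** A geometric sum is less than twice its largest term. Thus the lifts gained after the turn do not
    make up for the loss given by [expo_far]. *)
Lemma lift_upto_lt a b : (a <= b <= k)%N ->
  (lift_upto b < lift_upto a + 2 * radix ^ (k - a))%N.
Proof.
move=> /andP[ab bk].
suff : (lift_upto b + 2 * radix ^ (k - b) <= lift_upto a + 2 * radix ^ (k - a))%N.
  by have := radix_exp_gt0 (k - b); lia.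
elim: b ab bk => [|b IHb]; first by rewrite leqn0 => /eqP ->.
rewrite leq_eqVlt => /predU1P[-> //|]; rewrite ltnS => ab bk.
apply: leq_trans (IHb ab (ltnW bk)); rewrite {1}/lift_upto big_ord_recr /=.
rewrite -/(lift_upto b) (_ : k - b = (k - b.+1).+1)%N; last by lia.
by rewrite expnS; have := radix_gt1; nia.
Qed.

Lemma lift_max j : (lift j <= lift_upto k)%N.
Proof. by apply: lift_upto_mono; lia. Qed.

Lemma liftE j : (j <= k)%N -> lift j = lift_upto j.
Proof. by move=> jk; congr lift_upto; lia. Qed.

(** Up to the turn, the step from [i] to [i.+1] loses less than [radix ^ (k - i)] in [expo] by
    [expo_close] and gains exactly this in [lift]. Just after a turn [j0 < k], [expo_far] gives a
    loss that all later lifts together do not recover. Past [k] the lift does not exceed that at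
    [k], while the heights still decrease. *)
Lemma turn_dominates (d : nat -> nat) :
  (forall i j, (i < j < 2 * k.+1)%N -> (d j < d i)%N) ->
  (forall j, (j < 2 * k.+1)%N -> (d j < g ^ k.+1)%N) ->
  let j0 := turn g k.+1 (mkseq d k.+1) in
  (j0 <= k)%N /\ forall j, (j < 2 * k.+1)%N -> j != j0 ->
    (lift j + expo (d j) < lift j0 + expo (d j0))%N.
Proof.
move=> d_dec d_lt j0.
have [j0k close far] := turn_spec g (size_mkseq d k.+1); rewrite -/j0 in j0k close far.
split=> //.
have before j : (j < j0)%N -> (lift j + expo (d j) < lift j0 + expo (d j0))%N.
  have step i : (i < j0)%N -> (lift i + expo (d i) < lift i.+1 + expo (d i.+1))%N.
    move=> ij; have ik : (i < k)%N by apply: leq_trans ij j0k.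
    have := close _ ij; rewrite !nth_mkseq ?ltnS //; last exact: ltnW.
    move=> /esym cl; rewrite (liftE (ltnW ik)) (liftE ik).
    have -> : lift_upto i.+1 = (lift_upto i + radix ^ (k - i))%N.
      by rewrite /lift_upto big_ord_recr.
    rewrite -addnA ltn_add2l addnC.
    by apply: expo_close cl; [lia | apply: d_lt; lia].
  move=> jj0; suff climb n : (j < n <= j0)%N ->
      (lift j + expo (d j) < lift n + expo (d n))%N by apply: climb; rewrite jj0 leqnn.
  elim: n => // n IHn /andP[]; rewrite ltnS leq_eqVlt => /predU1P[->|jn] nj0.
    exact: step.
  by apply: ltn_trans (IHn _) (step _ nj0); rewrite jn ltnW.
have after_k j : (k < j < 2 * k.+1)%N -> (lift j + expo (d j) < lift k + expo (d k))%N.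
  by move=> jk; rewrite (liftE (leqnn k)) -addnS leq_add ?lift_max // expo_lt // d_dec.
have after j : (j0 < j <= k)%N -> (lift j + expo (d j) < lift j0 + expo (d j0))%N.
  move=> /andP[j0j jk]; rewrite !liftE //.
  have := far (leq_trans j0j jk); rewrite !nth_mkseq //; last by lia.
  rewrite eq_sym => /expo_far h; have := h _ _; rewrite leq_subr d_dec; last by lia.
  move=> /(_ isT isT).
  have : (expo (d j) <= expo (d j0.+1))%N.
    move: j0j; rewrite leq_eqVlt => /predU1P[-> //|j0j].
    by apply/ltnW/expo_lt/d_dec; lia.
  have := @lift_upto_lt j0 j; rewrite (ltnW j0j) jk => /(_ isT); lia.
move=> j j2k; rewrite neq_ltn => /orP[/before //|j0j].
have [jk|kj] := leqP j k; first by apply: after; rewrite j0j.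
move: j0k; rewrite leq_eqVlt => /predU1P[->|j0k]; first by rewrite after_k // kj.
by apply: ltn_trans (after_k _ _) (after _ _); rewrite ?kj ?j0k ?leqnn.
Qed.

End Exponents.

(** * The linear functional *)

Local Open Scope ring_scope.

Section Points.
Variables (R : realFieldType) (w : nat -> R).
Hypothesis w_gt0 : forall t, 0 < w t.
Hypothesis w_growth : forall t, 3 * w t <= w t.+1.

(** Digit [t] carries the weight [w t.+1] because leaves whose highest distinct digit is [t] meet at
    height [t.+1]. *)
Definition point m x := \sum_(t < m) (odd (x %/ 2 ^ t))%:R * w t.+1.

Lemma point_bound m x : 0 <= point m x <= w m.+1 / 2.
Proof.
elim: m => [|m /andP[IH0 IH1]].
  by rewrite /point big_ord0 lexx divr_ge0 // ltW.
rewrite /point big_ord_recr /= -/(point m x).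
by have := w_growth m.+1; have := w_gt0 m.+1; case: odd => /=; lra.
Qed.

(** The highest distinct digit is 0 in [x] and 1 in [y] and contributes [w (hgt x y)]; by
    [point_bound] the lower digits change this by at most half of it. *)
Lemma point_diff m x y : (x < y)%N -> (hgt x y <= m)%N ->
  w (hgt x y) / 2 <= point m y - point m x <= 3 * w (hgt x y) / 2.
Proof.
move=> xy; elim: m => [|m IHm].
  by rewrite hgt_leE !divn1 => /eqP yx; rewrite yx ltnn in xy.
rewrite leq_eqVlt ltnS => /predU1P[xy_m|xy_m]; last first.
  rewrite /point !big_ord_recr /= -/(point m x) -/(point m y).
  move: (xy_m); rewrite hgt_leE => /eqP ->; have := IHm xy_m; lra.
have /negP : ~ (hgt x y <= m)%N by rewrite xy_m ltnn.
have /eqP : (x %/ 2 ^ m.+1 == y %/ 2 ^ m.+1)%N by rewrite -hgt_leE xy_m.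
rewrite hgt_leE !divn_exp2S xy_m /point !big_ord_recr /= -/(point m x) -/(point m y).
have := leq_div2r (2 ^ m) (ltnW xy); have := point_bound m x; have := point_bound m y.
move: (x %/ _)%N (y %/ _)%N => a b /andP[y0 y1] /andP[x0 x1] ab ab2 nab.
have [-> ->] : odd a = false /\ odd b = true by lia.
by rewrite /= mul0r mul1r; lra.
Qed.

End Points.

Section Functional.
Variables (R : realFieldType) (k g m : nat).

(** Each term of the functional is within factors 1/2 and 3/2 of a power of [base]. Fewer than
    [2 * k.+1] terms, each at most 3/2 of a power smaller by a factor [base], must add up to less
    than half of the dominating power, so [base] has to exceed [6 * k.+1]. *)
Definition base : R := (6 * k.+1).+1%:R.

Definition wgt t : R := base ^+ expo k g t.

Definition coef j : R := (-1) ^+ j * base ^+ lift k g j.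

Definition functional (s : seq nat) : R :=
  \sum_(j < 2 * k.+1) coef j * (point wgt m (nth 0%N s j.+1) - point wgt m (nth 0%N s j)).

Lemma base_ge1 : 1 <= base.
Proof. by rewrite /base ler1n. Qed.

Lemma base_gt0 : 0 < base.
Proof. by apply: lt_le_trans base_ge1. Qed.

Lemma wgt_gt0 t : 0 < wgt t.
Proof. exact/exprn_gt0/base_gt0. Qed.

(** Reversal negates the differences and sends index [j] to [2 * k + 1 - j], which has the other
    parity and the same [lift]; the two signs cancel. *)
Lemma functional_rev s : size s = (2 * k.+1).+1 -> functional (rev s) = functional s.
Proof.
move=> szs; rewrite /functional (reindex_inj rev_ord_inj) /=; apply: eq_bigr => j _.
have jk := ltn_ord j.
have nthE i : (i <= 2 * k.+1)%N -> nth 0%N (rev s) i = nth 0%N s (2 * k.+1 - i).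
  by move=> ik; rewrite nth_rev szs ?ltnS // subSS.
rewrite !nthE ?leq_subr //; last by rewrite subnSK ?leq_subr.
rewrite subKn // subnSK // subKn; last exact: ltnW.
rewrite /coef -signr_odd -[in RHS]signr_odd.
rewrite (_ : odd (2 * k.+1 - j.+1) = ~~ odd j) ?signrN; last by lia.
rewrite (_ : lift k g (2 * k.+1 - j.+1) = lift k g j); last first.
  by congr lift_upto; lia.
by rewrite !mulNr -mulrN opprB.
Qed.

Hypothesis g_gt0 : (0 < g)%N.

Lemma wgt_growth t : 3 * wgt t <= wgt t.+1.
Proof.
apply: (@le_trans _ _ (base * wgt t)).
  by rewrite (ler_wpM2r (ltW (wgt_gt0 t))) // /base ler_nat; lia.
by rewrite /wgt -exprS ler_weXn2l ?base_ge1 // expo_lt.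
Qed.

Lemma functional_dominated (rv : bool) (s : seq nat) (j0 : nat) :
  {in s, forall x, x < 2 ^ m}%N -> size s = (2 * k.+1).+1 ->
  sorted (fun x y => if rv then y < x else x < y)%N s ->
  (j0 < 2 * k.+1)%N ->
  (forall j, (j < 2 * k.+1)%N -> j != j0 ->
    (lift k g j + expo k g (hgt (nth 0 s j) (nth 0 s j.+1)) <
     lift k g j0 + expo k g (hgt (nth 0 s j0) (nth 0 s j0.+1)))%N) ->
  (0 < functional s) = ~~ (odd j0 (+) rv).
Proof.
move=> sm szs ss j0k dom.
pose dif j := `|point wgt m (nth 0%N s j.+1) - point wgt m (nth 0%N s j)|.
(* The size of term [j] up to the factors of [difP]. Exponents are integers, so a strictly smaller
   one costs a full factor [base] ([qdom]). *)
pose q j := base ^+ (lift k g j + expo k g (hgt (nth 0%N s j) (nth 0%N s j.+1))).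
have difP j : (j < 2 * k.+1)%N ->
    point wgt m (nth 0%N s j.+1) - point wgt m (nth 0%N s j) = (-1) ^+ rv * dif j /\
    q j / 2 <= base ^+ lift k g j * dif j <= 3 * q j / 2.
  move=> jk; set x := nth 0%N s j; set y := nth 0%N s j.+1.
  have hm : (hgt x y <= m)%N.
    by apply: hgt_le_exp; apply: sm; rewrite mem_nth ?szs //; lia.
  have xy : if rv then (y < x)%N else (x < y)%N.
    by have := sortedP 0%N ss; apply; rewrite szs.
  have qE : q j = base ^+ lift k g j * wgt (hgt x y) by rewrite /q exprD.
  have qE1 : q j / 2 = base ^+ lift k g j * (wgt (hgt x y) / 2) by rewrite qE mulrA.
  have qE2 : 3 * q j / 2 = base ^+ lift k g j * (3 * wgt (hgt x y) / 2).
    by rewrite qE; field.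
  rewrite qE1 qE2 /dif -/x -/y.
  have b0 : 0 < base ^+ lift k g j by rewrite exprn_gt0 // base_gt0.
  have := wgt_gt0 (hgt x y).
  case: rv xy {ss} => xy w0.
    have := @point_diff _ _ wgt_gt0 wgt_growth m y x xy.
    rewrite hgtC => /(_ hm) /andP[h1 h2].
    have h0 : point wgt m y - point wgt m x < 0 by lra.
    rewrite ltr0_norm // opprB expr1 mulN1r opprB; split=> //.
    by rewrite !ler_pM2l // h1 h2.
  have /(_ hm) /andP[h1 h2] := @point_diff _ _ wgt_gt0 wgt_growth m x y xy.
  have h0 : 0 < point wgt m y - point wgt m x by lra.
  rewrite gtr0_norm // expr0 mul1r; split=> //.
  by rewrite !ler_pM2l // h1 h2.
have q_gt0 j : 0 < q j by rewrite exprn_gt0 // base_gt0.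
have qdom j : (j < 2 * k.+1)%N -> j != j0 -> base * q j <= q j0.
  by move=> jk jj0; rewrite /q -exprS ler_weXn2l ?base_ge1 // dom.
pose T j := (-1) ^+ j * (base ^+ lift k g j * dif j).
have -> : functional s = (-1) ^+ rv * \sum_(j < 2 * k.+1) T j.
  rewrite mulr_sumr; apply: eq_bigr => j _.
  by rewrite (difP j (ltn_ord j)).1 /T /coef; ring.
have Tabs j : `|T j| = base ^+ lift k g j * dif j.
  rewrite normrMsign ger0_norm //; apply: mulr_ge0; rewrite ?normr_ge0 //.
  by rewrite ltW ?exprn_gt0 ?base_gt0.
rewrite (bigD1 (Ordinal j0k)) //=; set S := \sum_(_ | _) _.
have Sq : base * `|S| <= 3 * k.+1%:R * q j0.
  apply: (@le_trans _ _ (\sum_(j < 2 * k.+1 | j != Ordinal j0k) (3 * q j0 / 2))).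
    rewrite -[X in X * _]gtr0_norm ?base_gt0 // -normrM mulr_sumr.
    apply: le_trans (ler_norm_sum _ _ _) _; apply: ler_sum => j jj0.
    rewrite normrM Tabs gtr0_norm ?base_gt0 //.
    have /andP[_ h] := (difP j (ltn_ord j)).2.
    have := ler_wpM2l (ltW base_gt0) h; have := qdom j (ltn_ord j) jj0; lra.
  rewrite sumr_const -mulr_natr.
  have : (#|[pred j : 'I_(2 * k.+1) | j != Ordinal j0k]|)%:R <= (2 * k.+1)%:R :> R.
    by rewrite ler_nat -[X in (_ <= X)%N]card_ord max_card.
  by move: (q_gt0 j0) => q0 c; rewrite natrM in c; nra.
have S_lt : `|S| < q j0 / 2.
  rewrite -(ltr_pM2l base_gt0); apply: le_lt_trans Sq _.
  have -> : base = 6 * k.+1%:R + 1 by rewrite /base -natr1 natrM.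
  by have := q_gt0 j0; lra.
have /andP[Tj0 _] := (difP j0 j0k).2; rewrite -Tabs in Tj0.
have [a []] : exists a, `|S| < a /\ T j0 = (-1) ^+ odd j0 * a.
  by exists `|T j0|; split; [lra | rewrite Tabs /T signr_odd].
rewrite ltr_norml => /andP[Sa1 Sa2] ->.
case: rv {ss difP}; case: odd; rewrite /= ?expr0 ?expr1 ?mulN1r ?mul1r;
  [apply/idP|apply/negbTE; rewrite -leNgt|apply/negbTE; rewrite -leNgt|apply/idP]; lra.
Qed.

End Functional.

(** * Size of homogeneous sets of leaves *)

Section Homogeneous.
Variables (R : realFieldType) (k g m : nat).
Hypothesis g_gt0 : (0 < g)%N.
Hypothesis m_lt : (m < g ^ k.+1)%N.

Local Notation F := (functional R k g m).

(** [F] reads only the first [(2 * k.+1).+1] entries, so subsequences of this length are tested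
    whatever the uniformity of the hypergraph. *)
Definition homogeneous (b : bool) (s : seq nat) :=
  forall u, subseq u s -> size u = (2 * k.+1).+1 -> (0 < F u) = b.

Lemma homogeneous_subseq b s u : homogeneous b s -> subseq u s -> homogeneous b u.
Proof. by move=> sb us v vu; apply: sb; apply: subseq_trans vu us. Qed.

(** The last [k.+2] leaves are set aside; they complete any [k.+1] earlier leaves to an argument of
    [F], whose sign is the parity of the turn of the heights of these earlier leaves. This parity is
    therefore constant and [turn_constant_bound] applies. *)
Lemma homogeneous_comb_bound (rv : bool) D s b : comb D s ->
  sorted (fun x y => if rv then y < x else x < y)%N s ->
  {in s, forall x, x < 2 ^ m}%N -> homogeneous b s ->
  (size s <= k.+2 + k.+1 * (g + k.+1))%N.
Proof.
move=> Ds ss sm sb; rewrite -leq_subLR.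
have [sk|ks] := leqP (size s) k.+2; first by move: sk; rewrite -subn_eq0 => /eqP ->.
set n := (size s - k.+2)%N.
have n_le : (n <= size s)%N by rewrite leq_subr.
have sz_drop : size (drop n s) = k.+2 by rewrite size_drop /n subKn // ltnW.
have combP u : subseq u s -> forall i j, (i < j < size u)%N ->
    hgt (nth 0%N u i) (nth 0%N u j) = D (nth 0%N u i) /\
    (D (nth 0%N u j) < D (nth 0%N u i))%N.
  move=> us i j /andP[ij ju]; have /(pairwiseP 0%N) h := subseq_pairwise us Ds.
  by have /andP[/eqP] := h i j (ltn_trans ij ju) ju ij.
have tail_subseq u : subseq u (take n s) -> subseq (u ++ drop n s) s.
  by move=> us; rewrite -[X in subseq _ X](cat_take_drop n) cat_subseq.
have turnE u : subseq u (take n s) -> size u = k.+1 ->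
    odd (turn g k.+1 (map D u)) = ~~ b (+) rv.
  move=> un uk; set v := u ++ drop n s.
  have vs : subseq v s := tail_subseq u un.
  have vk : size v = (2 * k.+1).+1 by rewrite size_cat uk sz_drop; lia.
  pose d j := D (nth 0%N v j).
  have -> : map D u = mkseq d k.+1.
    apply: (@eq_from_nth _ 0%N) => [|i]; rewrite size_map ?size_mkseq // => iu.
    by rewrite (nth_map 0%N) // nth_mkseq -?uk // /d nth_cat iu.
  have hd j : (j < 2 * k.+1)%N -> hgt (nth 0%N v j) (nth 0%N v j.+1) = d j.
    by move=> jk; apply: (combP v vs j j.+1 _).1; rewrite vk ltnSn ltnS.
  have [||j0k dom] := @turn_dominates k g g_gt0 d.
  - by move=> i j /andP[ij jk]; apply: (combP v vs i j _).2; rewrite ij vk ltnW.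
  - move=> j jk; rewrite -hd //; apply: leq_ltn_trans m_lt.
    by apply: hgt_le_exp; apply: sm; apply: (mem_subseq vs); rewrite mem_nth // vk; lia.
  have := sb v vs vk.
  rewrite (@functional_dominated _ k g m g_gt0 rv v (turn g k.+1 (mkseq d k.+1))) //.
  - by move=> <-; rewrite negbK addbK.
  - by move=> x /(mem_subseq vs); apply: sm.
  - apply: subseq_sorted vs ss; case: (rv) => x y z; last exact: ltn_trans.
    by move=> yx xz; apply: ltn_trans xz yx.
  - by lia.
  - by move=> j jk jj0; rewrite !hd //; [apply: dom | lia].
have := @turn_constant_bound g g_gt0 k (map D (take n s)) (~~ b (+) rv) 0.
rewrite size_map size_takel //; apply.
- rewrite sorted_map; apply: pairwise_sorted.
  by apply: sub_pairwise (subseq_pairwise (take_subseq s n) Ds) => x y /andP[].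
- move=> _ /mapP[x xs ->]; apply: divn_small; apply: leq_ltn_trans m_lt.
  (* [D x] is known to be a height only if a leaf follows [x] in the comb; one of those set aside
     does. *)
  set y := nth 0%N (drop n s) 0.
  have xy : subseq [:: x; y] s.
    apply: subseq_trans (tail_subseq [:: x] _); last by rewrite sub1seq.
    by rewrite (@cat_subseq _ [:: x] [:: y]) // sub1seq mem_nth // sz_drop.
  rewrite -(combP _ xy 0%N 1%N isT).1.
  by apply: hgt_le_exp; apply: sm; apply: (mem_subseq xy); rewrite !inE eqxx ?orbT.
- move=> v /subseqP[msk _ ->]; rewrite -map_mask size_map.
  by apply: turnE; apply: mask_subseq.
Qed.

(** The step from [l] to [r] has the strictly largest height, and its index [(size l).-1] is [k] or
    [k.+1], where [lift] is maximal. So this term dominates. *)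
Lemma sign_balanced t (l r : seq nat) : sorted ltn (l ++ r) ->
  {in l ++ r, forall x, x < 2 ^ m}%N ->
  {in l &, forall x y, hgt x y <= t}%N ->
  {in r &, forall x y, hgt x y <= t}%N ->
  {in l & r, forall x y, hgt x y = t.+1} ->
  size (l ++ r) = (2 * k.+1).+1 -> (k < size l <= k.+2)%N ->
  (0 < F (l ++ r)) = odd (size l).
Proof.
move=> ss sm lt rt lrt szs /andP[kl lk].
have mem_nat (s : seq nat) i : (i < size s)%N -> nth 0%N s i \in s by apply: mem_nth.
have szr : (size l + size r = (2 * k.+1).+1)%N by rewrite -size_cat.
rewrite (@functional_dominated _ k g m g_gt0 false (l ++ r) (size l).-1) //; [|lia|].
  by rewrite addbF; lia.
move=> j jk jl; set j0 := (size l).-1.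
have -> : lift k g j0 = lift_upto k g k by congr lift_upto; rewrite /j0; lia.
rewrite -addnS leq_add ?lift_max // expo_lt //.
have -> : hgt (nth 0%N (l ++ r) j0) (nth 0%N (l ++ r) j0.+1) = t.+1.
  have [j0l j1l] : (j0 < size l)%N /\ (j0.+1 < size l)%N = false by rewrite /j0; lia.
  by rewrite !nth_cat j0l j1l; apply: lrt; apply: mem_nat; lia.
rewrite ltnS !nth_cat; case: (ltnP j.+1 (size l)) => jl'.
  by rewrite (ltnW jl'); apply: lt; apply: mem_nat; lia.
have jl2 : (j < size l)%N = false by lia.
by rewrite jl2; apply: rt; apply: mem_nat; lia.
Qed.

Lemma homogeneous_bound s b : sorted ltn s -> {in s, forall x, x < 2 ^ m}%N ->
  homogeneous b s -> (size s <= k.+2 * (2 * (k.+2 + k.+1 * (g + k.+1))))%N.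
Proof.
move=> ss sm sb.
have ltr : transitive ltn by exact: ltn_trans.
have [|t l r lrs szl szr lt rt lrt|D [D' [l [r [[ls Dl rs Dr szs] _]]]]] :=
    @comb_extract k.+1 m 0 s ss.
- by move=> x /sm; apply: divn_small.
- have half l' r' : subseq l' l -> subseq r' r -> size l' + size r' = (2 * k.+1).+1 ->
      (k < size l' <= k.+2)%N -> odd (size l') = b.
    move=> sl sr sz kl; have sub : subseq (l' ++ r') s.
      by apply: subseq_trans lrs; apply: cat_subseq.
    rewrite -(@sign_balanced t l' r') ?size_cat //.
    + by apply: sb; rewrite ?size_cat.
    + exact: (subseq_sorted ltr sub ss).
    + by move=> x /(mem_subseq sub); apply: sm.
    + by move=> x y /(mem_subseq sl) xl /(mem_subseq sl) yl; apply: lt.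
    + by move=> x y /(mem_subseq sr) xl /(mem_subseq sr) yl; apply: rt.
    + by move=> x y /(mem_subseq sl) xl /(mem_subseq sr) yl; apply: lrt.
  (* Taking [k.+1] leaves on the left and [k.+2] on the right, or conversely, gives opposite
     signs. *)
  have := half (take k.+1 l) r (take_subseq _ _) (subseq_refl _).
  rewrite size_takel ?szl // szr => h1.
  have := half l (take k.+1 r) (subseq_refl _) (take_subseq _ _).
  rewrite size_takel ?szr // szl => h2.
  have /= : odd k.+1 = odd k.+2 by rewrite h1 ?h2 //; lia.
  by case: odd.
apply: leq_trans szs _; rewrite leq_pmul2l // mul2n -addnn leq_add //.
  apply: (@homogeneous_comb_bound false D l b) => //.
  - exact: (subseq_sorted ltr ls ss).
  - by move=> x /(mem_subseq ls); apply: sm.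
  - exact: homogeneous_subseq sb ls.
(* The second comb runs from right to left; [functional_rev] carries homogeneity over to it. *)
apply: (@homogeneous_comb_bound true D' r b) => //.
- by rewrite -[r]revK rev_sorted; exact: (subseq_sorted ltr rs ss).
- by move=> x xr; apply: sm; apply: (mem_subseq rs); rewrite mem_rev.
- move=> u ur szu; rewrite -functional_rev //; apply: sb; last by rewrite size_rev.
  by apply: subseq_trans rs; rewrite subseq_rev.
Qed.

End Homogeneous.

(** * The hypergraph *)

Section Sets.
Variable N : nat.

Definition elements (A : {set 'I_N}) : seq nat := map val (enum A).

Lemma size_elements A : size (elements A) = #|A|.
Proof. by rewrite size_map -cardE. Qed.

Lemma mem_elements A (i : 'I_N) : (val i \in elements A) = (i \in A).
Proof. by rewrite mem_map ?mem_enum //; apply: val_inj. Qed.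

Lemma elements_lt A : {in elements A, forall x, x < N}%N.
Proof. by move=> _ /mapP[i _ ->]; apply: ltn_ord. Qed.

Lemma sorted_elements A : sorted ltn (elements A).
Proof.
rewrite sorted_map {1}/(enum _); apply: sorted_filter.
  by move=> i j l; apply: ltn_trans.
by rewrite -enumT -sorted_map val_enum_ord iota_ltn_sorted.
Qed.

Lemma eq_elements A s : sorted ltn s -> elements A =i s -> elements A = s.
Proof. exact: (irr_sorted_eq ltn_trans ltnn (sorted_elements A)). Qed.

Lemma elements_surj s : sorted ltn s -> {in s, forall x, x < N}%N ->
  exists A, elements A = s.
Proof.
move=> ss sN; exists [set i | val i \in s]; apply: eq_elements => // x.
apply/idP/idP => [xA|xs].
  by move: (xA); rewrite -[x]/(val (Ordinal (elements_lt xA))) mem_elements inE.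
by rewrite -[x]/(val (Ordinal (sN x xs))) mem_elements inE.
Qed.

End Sets.

Section Construction.
Variables (R : realType) (k g m r N : nat).
Hypothesis kr : (2 * k.+1 <= r)%N.

Local Notation F := (functional R k g m).

(** The uniformity is written [r.+1] so that [inord] below lands in the index type of the points. *)
Definition edges : {set {set 'I_N}} :=
  [set e : {set 'I_N} | (#|e| == r.+1) && (0 < F (elements e))].

Lemma edges_uniform : uniform r.+1 edges.
Proof. by move=> e; rewrite inE => /andP[/eqP]. Qed.

Definition coordinate j : 'I_(r.+1 * 1) := mxvec_index (inord j) ord0.

Definition functional_poly : {mpoly R[r.+1 * 1]} :=
  \sum_(j < 2 * k.+1) (coef R k g j *: 'X_(coordinate j.+1) +
                       - coef R k g j *: 'X_(coordinate j)).

Lemma msize_functional_poly : (msize functional_poly <= 2)%N.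
Proof.
have msizeD (p q : {mpoly R[r.+1 * 1]}) :
    (msize p <= 2 -> msize q <= 2 -> msize (p + q) <= 2)%N.
  by move=> p2 q2; apply: leq_trans (mmeasureD_le _ p q) _; rewrite geq_max p2.
have msizeZX c j : (msize (c *: 'X_(coordinate j) : {mpoly R[r.+1 * 1]}) <= 2)%N.
  by apply: leq_trans (msizeZ_le _ _) _; rewrite msizeX mdeg1.
apply: (big_ind (fun p : {mpoly R[r.+1 * 1]} => msize p <= 2)%N) => //.
  by rewrite msize0.
by move=> j _; apply: msizeD.
Qed.

Lemma meval_functional_poly (s : seq nat) :
  functional_poly.@[fun l => mxvec (\matrix_(i < r.+1)
    (const_mx (point (wgt R k g) m (nth 0%N s i)) : 'rV[R]_1)) 0 l] = F s.
Proof.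
rewrite /functional_poly raddf_sum /functional; apply: eq_bigr => j _ /=.
rewrite mevalD !mevalZ !mevalXU /coordinate !mxvecE !mxE !inordK //.
- by ring.
- by have := ltn_ord j; lia.
- by have := ltn_ord j; lia.
Qed.

Lemma edges_semialgebraic : semialgebraic R r.+1 1 1 1 edges.
Proof.
have cN : #|'I_N| = N := card_ord N.
exists (cast_ord cN), (fun i => const_mx (point (wgt R k g) m (val i))),
  (fun _ => functional_poly), (fun t => if tnth t ord0 is Plus then true else false).
split; first by exists (cast_ord (esym cN)); [apply: cast_ordK | apply: cast_ordKV].
  by move=> _; apply: msize_functional_poly.
move=> i i_mono; pose s := [seq val (i j) | j <- enum 'I_r.+1].
have ss : sorted ltn s.
  rewrite sorted_map; apply: sub_sorted (_ : sorted (relpre val ltn) _).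
    by move=> a b; apply: i_mono.
  by rewrite -sorted_map val_enum_ord iota_ltn_sorted.
set e := [set _ | _ in _].
have eE : elements e = s.
  apply: eq_elements => // x; apply/idP/idP.
    move=> xe; move: (xe); rewrite -[x]/(val (Ordinal (elements_lt xe))) mem_elements.
    move=> /imsetP[j _ ->] /=; apply/mapP; exists j => //; exact: mem_enum.
  move=> /mapP[j _ ->].
  by rewrite -[val (i j)]/(val (cast_ord cN (i j))) mem_elements;
    apply/imsetP; exists j.
rewrite inE -size_elements eE size_map size_enum_ord eqxx /= tnth_mktuple.
rewrite (_ : _.@[_] = F s); last first.
  rewrite -meval_functional_poly; apply: meval_eq => l; congr (mxvec _ 0 l).
  apply/matrixP => a b; rewrite !mxE /s (nth_map ord0) ?size_enum_ord //.
  by rewrite nth_ord_enum.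
by rewrite /sign_of; case: ifP => // _; case: ifP.
Qed.

Lemma ramsey_property_bound n :
  (0 < g)%N -> (m < g ^ k.+1)%N -> (N <= 2 ^ m)%N ->
  ramsey_property R r.+1 1 1 1 n N ->
  (n <= r.+1 + k.+2 * (2 * (k.+2 + k.+1 * (g + k.+1))))%N.
Proof.
move=> g_gt0 mg Nm /(_ 'I_N edges (card_ord N) edges_uniform edges_semialgebraic).
move=> [S [Sn hS]]; rewrite -leq_subLR.
have [nr|rn] := leqP n r.+1; first by move: nr; rewrite -subn_eq0 => /eqP ->.
have [b hb] : exists b, forall s, subseq s (elements S) -> size s = r.+1 -> (0 < F s) = b.
  have eS s : subseq s (elements S) -> size s = r.+1 ->
      exists e : {set 'I_N}, [/\ e \subset S, #|e| = r.+1 & (e \in edges) = (0 < F s)].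
    move=> sS sr; have [|x /(mem_subseq sS)|e es] := @elements_surj N s _ _.
    - exact: (subseq_sorted ltn_trans sS (sorted_elements S)).
    - exact: elements_lt.
    exists e; rewrite inE -size_elements es sr eqxx; split=> //.
    by apply/subsetP => i; rewrite -!mem_elements es; apply: mem_subseq.
  case: hS => hS; [exists true|exists false] => s sS sr;
    have [e [eS' er <-]] := eS s sS sr; first exact: hS.
  exact/negbTE/hS.
set L := elements S in hb; have szL : size L = n by rewrite size_elements.
have := @homogeneous_bound R k g m g_gt0 mg (take (n - r.+1) L) b.
rewrite size_takel ?szL ?leq_subr //; apply.
- exact: (subseq_sorted ltn_trans (take_subseq _ _) (sorted_elements S)).
- by move=> x /mem_take /elements_lt xN; apply: leq_trans xN Nm.
(* The last [r.+1] elements of [L] are kept out of the tested list. Some of them pad [u] to the size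
   of an edge, and [F] ignores them. *)
move=> u uL szu; pose v := u ++ take (r.+1 - (2 * k.+1).+1) (drop (n - r.+1) L).
have vL : subseq v L.
  rewrite -[X in subseq _ X](cat_take_drop (n - r.+1)) cat_subseq //.
  exact: take_subseq.
rewrite -(hb v vL); last first.
  by rewrite size_cat szu size_takel ?size_drop ?szL; lia.
congr (0 < _); apply: eq_bigr => j _; have := ltn_ord j.
by rewrite !nth_cat szu ltnS => jk; rewrite jk ltnS ltnW.
Qed.

End Construction.

(** * Lower bound on the Ramsey number *)

Lemma ramsey_numberP (R : realType) (r d D m n : nat) :
  ramsey_property R r d D m n (ramsey_number R r d D m n).
Proof. by rewrite /ramsey_number; case: ex_minnP => N /asboolP. Qed.

(** Any semi-algebraic hypergraph on [N] vertices shows this, as its homogeneous set of size [n] is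
    a set of vertices; the construction with trivial parameters is one. It settles small [n] in the
    theorem. *)
Lemma ramsey_number_ge (R : realType) (r n : nat) : (2 < r)%N ->
  (n <= ramsey_number R r 1 1 1 n)%N.
Proof.
case: r => // r r2; have := @ramsey_numberP R r.+1 1 1 1 n.
set N := ramsey_number _ _ _ _ _ _ => h.
have [S [<- _]] := h _ _ (card_ord N) (@edges_uniform R 0 1 0 r N)
  (@edges_semialgebraic R 0 1 0 r N r2).
by rewrite -[X in (_ <= X)%N](card_ord N) max_card.
Qed.

Lemma ramsey_number_gt_exp (R : realType) (r n : nat) (k := (r %/ 2 - 1)%N) :
  (4 <= r)%N -> (9 * r ^ 3 <= n)%N ->
  (2 ^ ((n %/ (4 * r ^ 2)) ^ k).-1 < ramsey_number R r 1 1 1 n)%N.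
Proof.
move=> r4 n_large; set g := (n %/ _)%N.
have gn : (g * (4 * r ^ 2) <= n)%N := leq_trunc_div _ _.
have r_gt0 : (0 < r)%N by apply: leq_trans r4.
have g0 : (0 < g)%N.
  rewrite divn_gt0 ?muln_gt0 ?expn_gt0 ?r_gt0 //; apply: leq_trans n_large.
  by rewrite (expnS _ 2) mulnCA leq_mul //; lia.
have -> : k = (k.-1).+1 by rewrite /k; lia.
have kr : (k.-1.+2 <= r)%N by rewrite /k; lia.
have kr' : (2 * k.-1.+1 <= r.-1)%N by rewrite /k; lia.
move: k.-1 kr kr' => {}k kr kr'; rewrite ltnNge; apply/negP => small.
have gk : ((g ^ k.+1).-1 < g ^ k.+1)%N by rewrite prednK // expn_gt0 g0.
have := @ramsey_property_bound R k g _ r.-1 _ kr' n g0 gk small.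
rewrite prednK // => /(_ (@ramsey_numberP R r 1 1 1 n)).
apply/negP; rewrite -ltnNge.
(* The choice of [g] makes [2 * r ^ 2 * g] at most [n / 2], and [9 * r ^ 3 <= n] puts the remaining
   terms [r + 2 * r ^ 2 + 2 * r ^ 3] below [n / 2]. *)
apply: (@leq_ltn_trans (r + r * (2 * (r + r * (g + r))))).
  by rewrite leq_add2l !(leq_mul, leq_add) // ltnW.
move: n_large gn; rewrite !expnS expn0 !muln1 => n_large gn.
have : (4 * 4 * r <= r * (r * r))%N by rewrite mulnA !leq_mul.
have : (4 * (r * r) <= r * (r * r))%N by rewrite leq_mul.
by move: n_large gn; rewrite !mulnDr; lia.
Qed.

Theorem theorem4 (R : realType) (r : nat) (hr : (4 <= r)%N) :
  exists c : R, 0 < c /\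
    forall n : nat, (2 <= n)%N ->
      2 `^ (c * n%:R ^+ (r %/ 2 - 1)) <= (ramsey_number R r 1 1 1 n)%:R.
Proof.
set k := (r %/ 2 - 1)%N; pose n0 := (9 * r ^ 3)%N.
have r_gt0 : (0 < r)%N by apply: leq_trans hr.
have n0_gt0 : (0 < n0)%N by rewrite muln_gt0 expn_gt0 r_gt0.
have n0R : 0 < n0%:R :> R by rewrite ltr0n.
(* The exponent becomes half of [(n / n0) ^ k]. For [n < n0] it is at most 1, and [2 <= n] is a
   lower bound already. For larger [n] it is at most [g ^ k / 2], hence at most [g ^ k - 1]. *)
exists (2^-1 * n0%:R ^- k); split.
  by rewrite mulr_gt0 ?invr_gt0 ?exprn_gt0.
move=> n n2; rewrite -mulrA (mulrC (n0%:R ^- k)) -expr_div_n.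
have [n_large|n_small] := leqP n0 n; last first.
  apply: (@le_trans _ _ 2); last first.
    by rewrite ler_nat; apply: leq_trans n2 (ramsey_number_ge _ _ _); lia.
  rewrite -[leRHS]powRr1 // ler_powR ?ler1n //.
  apply: (@le_trans _ _ (2^-1 * 1)); last by lra.
  rewrite ler_pM2l ?invr_gt0 // exprn_ile1 ?divr_ge0 ?ler0n //.
  by rewrite ler_pdivrMr // mul1r ler_nat ltnW.
set g := (n %/ (4 * r ^ 2))%N.
have r2_gt0 : (0 < 4 * r ^ 2)%N by rewrite muln_gt0 expn_gt0 r_gt0.
have n0_ge : (9 * (4 * r ^ 2) <= n0)%N by rewrite leq_mul2l [(r ^ 3)%N]expnS leq_mul.
have g2 : (2 <= g)%N by rewrite leq_divRL //; lia.
(* Here [n] is less than [g.+1 * (4 * r ^ 2)], and [g.+1 <= 9 * g]. *)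
have g_big : (n <= g * n0)%N.
  apply: leq_trans (ltnW (ltn_ceil n r2_gt0)) _; rewrite -/g.
  apply: leq_trans (leq_mul (leqnn g) n0_ge).
  by rewrite [X in (_ <= X)%N]mulnA leq_mul2r; lia.
apply: (@le_trans _ _ (2 ^ (g ^ k).-1)%:R); last first.
  by rewrite ler_nat ltnW // ramsey_number_gt_exp.
rewrite natrX -[leRHS]powR_mulrn // ler_powR ?ler1n //.
apply: (@le_trans _ _ (2^-1 * (g ^ k)%:R)).
  rewrite ler_pM2l ?invr_gt0 // natrX lerXn2r ?nnegrE ?divr_ge0 ?ler0n //.
  by rewrite ler_pdivrMr // -natrM ler_nat.
have gk2 : (2 <= g ^ k)%N.
  by apply: leq_trans g2 _; rewrite -[X in (X <= _)%N]expn1 leq_pexp2l // /k; lia.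
rewrite -subn1 natrB; last exact: ltnW.
by move: gk2; rewrite -(ler_nat R); lra.
Qed.
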